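(* Let $R$ be a $D$-ring, let $\mathcal X = \mathcal{SH}(R)\setminus\{0\}$ be the set of all non-zero $sh$-ideals of $R$, and equip $\mathcal X$ with the $W$-topology. Then: (1) $\mathcal X$ has derived dimension if and only if $R$ has dual-classical Krull dimension. (2) When these dimensions exist, writing $d(\mathcal X)$ for the derived dimension of $\mathcal X$ and $\mathrm{d.cl.}k\text{-}\mathrm{dim}\,R$ for the dual-classical Krull dimension of $R$, one has $$\mathrm{d.cl.}k\text{-}\mathrm{dim}\,R \;\le\; d(\mathcal X)\;\le\; \mathrm{d.cl.}k\text{-}\mathrm{dim}\,R + 1 .$$ Moreover, if $d(\mathcal X)$ is a limit ordinal then $d(\mathcal X) = \mathrm{d.cl.}k\text{-}\mathrm{dim}\,R$; otherwise $d(\mathcal X) = \mathrm{d.cl.}k\text{-}\mathrm{dim}\,R + 1$.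
   Context: All rings are associative with $1\neq 0$ (not necessarily commutative); ''ideal'' means two-sided ideal. A $D$-ring is a ring whose lattice of ideals is distributive. An ideal $L$ of $R$ is strongly hollow (an $sh$-ideal) if for all ideals $A,B$ of $R$, $L\subseteq A+B$ implies $L\subseteq A$ or $L\subseteq B$. $\mathcal{SH}(R)$ is the set of all $sh$-ideals; it always contains $0$. Dual-classical Krull dimension: ordinals are extended by $-1$, with $-1<0$ and $-1+1=0$. Put $\mathcal Y=\mathcal{SH}(R)$, $\mathcal Y_{-1}=\{0\}$, and for each ordinal $\alpha\ge 0$ let $\mathcal Y_\alpha$ be the set of all $L\in\mathcal Y$ such that for every $L'\in\mathcal Y$ with $L'\subsetneq L$ there is $\beta<\alpha$ (possibly $\beta=-1$) with $L'\in\mathcal Y_\beta$. $R$ has dual-classical Krull dimension if $\mathcal Y_\alpha=\mathcal Y$ for some $\alpha\geq -1$; the smallest such $\alpha$ is denoted $\mathrm{d.cl.}k\text{-}\mathrm{dim}\,R$. $W$-topology: for an ideal $I$ of $R$ put $V(I)=\{L\in\mathcal X: L\subseteq I\}$. The $W$-topology is the topology on $\mathcal X$ having the sets $V(I)$ ($I$ an ideal of $R$) as a base of open sets. Derived dimension: for a subset $A$ of a topological space $X$, a point $x\in X$ is a limit point of $A$ if every open set containing $x$ meets $A$ in a point different from $x$; $A'$ is the set of limit points of $A$. Define $X_0=X$, $X_{\alpha+1}=(X_\alpha)'$, and $X_\alpha=\bigcap_{\beta<\alpha}X_\beta$ for limit $\alpha$ (limit ordinals are non-zero). $X$ has derived dimension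 if $X_\alpha=\emptyset$ for some ordinal $\alpha$; the smallest such $\alpha$ is the derived dimension $d(X)$. *)

(* Defs.v *)
From HB Require Import structures.
From mathcomp Require Import all_boot all_order all_algebra.
From mathcomp Require Import all_classical topology.

Set Implicit Arguments.
Unset Strict Implicit.
Unset Printing Implicit Defensive.

Import GRing.Theory.
Local Open Scope classical_set_scope.
Local Open Scope ring_scope.

(** Ordinals.  A well-founded tree [Node I f] denotes the least ordinal that is
    strictly greater than the ordinals denoted by the [f i].  With classical
    logic [tle] compares the denoted ordinals, and an ordinal is a class of
    trees for the equivalence associated with [tle]. *)

Inductive tree : Type := Node (I : Type) (f : I -> tree).

Fixpoint tle (s t : tree) : Prop :=
  let: Node A f := s in
  let: Node B g := t in
  forall i : A, exists j : B, tle (f i) (g j).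

Definition tlt (s t : tree) : Prop :=
  let: Node B g := t in exists j : B, tle s (g j).

Record ord : Type := MkOrd {
  oclass : tree -> Prop;
  oclassP : exists t, oclass = (fun s => tle s t /\ tle t s) }.

Definition ord_of (t : tree) : ord := @MkOrd _ (ex_intro _ t erefl).
Definition orepr (a : ord) : tree := projT1 (cid (oclassP a)).

Definition olt (a b : ord) : Prop := tlt (orepr a) (orepr b).
Definition ole (a b : ord) : Prop := tle (orepr a) (orepr b).
Definition ozero : ord := ord_of (Node (of_void tree)).
Definition osucc (a : ord) : ord := ord_of (Node (fun _ : unit => orepr a)).
Definition olimit (a : ord) : Prop := a <> ozero /\ forall b, a <> osucc b.

Lemma tle_refl t : tle t t.
Proof. by elim: t => A f IH i; exists i; exact: IH. Qed.

Lemma tle_trans s t u : tle s t -> tle t u -> tle s u.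
Proof.
elim: s t u => I f IH [J g] [K h] /= st tu i.
by have [j fg] := st i; have [k gh] := tu j; exists k; exact: IH fg gh.
Qed.

Lemma tltW s t : tlt s t -> tle s t.
Proof.
elim: s t => I f IH [J g] [j /= sj] i; exists j.
apply: IH; move: sj; case: (g j) => K h /(_ i) [k fk].
by exists k.
Qed.

Lemma tle_lt_trans s t u : tle s t -> tlt t u -> tlt s u.
Proof. by case: u => K h st [k tk]; exists k; exact: tle_trans tk. Qed.

Lemma tlt_le_trans s t u : tlt s t -> tle t u -> tlt s u.
Proof.
case: t u => J g [K h] [j sj] /(_ j) [k gk]; exists k; exact: tle_trans gk.
Qed.

Lemma tle_total s t : tle s t \/ tlt t s.
Proof.
elim: s t => I f IH [J g] /=.
have [H|/existsNP [i Hi]] := pselect (forall i, exists j, tle (f i) (g j)).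
  by left.
right; exists i; case E : (f i) => [K h] j.
have [gt|] := IH i (g j); first by case: Hi; exists j.
by rewrite E.
Qed.

Lemma tlt_wf : well_founded tlt.
Proof.
suff H t s : tle s t -> Acc tlt s by move=> t; exact: H (tle_refl t).
elim: t s => J g IH s st; constructor => r rs.
by have [j rj] := tlt_le_trans rs st; exact: IH rj.
Qed.

Lemma tlt_irr t : ~ tlt t t.
Proof.
by move: t; apply: (well_founded_ind tlt_wf) => t IH H; exact: (IH t H H).
Qed.

Lemma eq_ord_of s t : tle s t -> tle t s -> ord_of s = ord_of t.
Proof.
move=> st ts.
have E : (fun r => tle r s /\ tle s r) = (fun r => tle r t /\ tle t r).
  apply: funext => r; apply: propext.
  split=> -[rs sr]; split.
  - exact: tle_trans rs st.
  - exact: tle_trans ts sr.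
  - exact: tle_trans rs ts.
  - exact: tle_trans st sr.
rewrite /ord_of; move: (ex_intro _ s _) (ex_intro _ t _).
by rewrite E => p q; rewrite (Prop_irrelevance p q).
Qed.

Lemma oreprK a : ord_of (orepr a) = a.
Proof.
rewrite /orepr; case: (cid _) => t /=; case: a => c p /= E.
rewrite /ord_of; move: (ex_intro _ t _).
by rewrite -E => q; rewrite (Prop_irrelevance p q).
Qed.

Lemma ord_ofK t : tle (orepr (ord_of t)) t /\ tle t (orepr (ord_of t)).
Proof.
rewrite /orepr; case: (cid _) => u /= /(congr1 (fun c => c t)) E.
by have [tu ut] : tle t u /\ tle u t by rewrite -E; split; exact: tle_refl.
Qed.

Lemma olt_wf : well_founded olt.
Proof.
move=> a; move: (tlt_wf (orepr a)); move E : (orepr a) => t H.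
elim: H a E => {}t _ IH a E; constructor => b ba.
by apply: IH (erefl (orepr b)); rewrite -E.
Qed.

Lemma olt_irr a : ~ olt a a. Proof. exact: tlt_irr. Qed.

Lemma olt_trans a b c : olt a b -> olt b c -> olt a c.
Proof. by move=> /tltW; exact: tle_lt_trans. Qed.

Lemma ole_eqVlt a b : ole a b <-> olt a b \/ a = b.
Proof.
split=> [ab|[/tltW //|->]]; last exact: tle_refl.
have [ba|] := tle_total (orepr b) (orepr a); last by left.
by right; rewrite -(oreprK a) -(oreprK b); exact: eq_ord_of.
Qed.

Lemma ole_total a b : ole a b \/ olt b a. Proof. exact: tle_total. Qed.

Lemma ozero_le a : ole ozero a.
Proof.
apply: tle_trans (proj1 (ord_ofK _)) _.
by case: (orepr a) => I f [].
Qed.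

Lemma olt_succ a b : olt b (osucc a) <-> ole b a.
Proof.
split=> [ba|ba].
  by have [] := tlt_le_trans ba (proj1 (ord_ofK _)).
by apply: tlt_le_trans (proj2 (ord_ofK _)); exists tt.
Qed.

Lemma ord_bound (I : Type) (f : I -> ord) : exists a, forall i, olt (f i) a.
Proof.
exists (ord_of (Node (fun i => orepr (f i)))) => i.
by apply: tlt_le_trans (proj2 (ord_ofK _)); exists i; exact: tle_refl.
Qed.

(** This instance of [ord_bound] puts the index types of [Node] in a universe
    at least as large as that of the rings, so that no chain of ideals is
    longer than every ordinal. *)
Lemma ord_bound_ideals (R : nzRingType) (f : set R -> ord) :
  exists a, forall L, olt (f L) a.
Proof. exact: ord_bound. Qed.

Inductive xord : Type := XMinus1 | XOrd of ord.
Coercion XOrd : ord >-> xord.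

Definition xlt (k l : xord) : Prop :=
  match k, l with
  | _, XMinus1 => False
  | XMinus1, XOrd _ => True
  | XOrd a, XOrd b => olt a b
  end.
Definition xle (k l : xord) : Prop := xlt k l \/ k = l.
Definition xsucc (k : xord) : xord :=
  if k is XOrd a then osucc a else ozero.

Section Ideals.
Variable R : nzRingType.
Implicit Types A B C I L : set R.

Record ideal I : Prop := Ideal {
  ideal0 : I 0;
  idealD : forall x y, I x -> I y -> I (x + y);
  idealMl : forall r x, I x -> I (r * x);
  idealMr : forall r x, I x -> I (x * r) }.

Definition ideal_sum A B : set R := [set x + y | x in A & y in B].

(** Meet and join in the lattice of ideals are intersection and sum. *)
Definition D_ring : Prop := forall A B C, ideal A -> ideal B -> ideal C ->
  A `&` ideal_sum B C = ideal_sum (A `&` B) (A `&` C).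

Definition sh_ideal L : Prop := ideal L /\
  forall A B, ideal A -> ideal B ->
    L `<=` ideal_sum A B -> L `<=` A \/ L `<=` B.

(** [dclY k] is the k-th term of the dual-classical Krull filtration of the set
    of strongly hollow ideals; [dclYE] is its recursive definition. *)
Inductive dclY : xord -> set (set R) :=
| dclY_minus1 : dclY XMinus1 [set 0]
| dclY_ord (a : ord) L of sh_ideal L
    & (forall L', sh_ideal L' -> L' `<` L -> exists2 b, xlt b a & dclY b L') :
    dclY a L.

Lemma dclYE :
  dclY XMinus1 = [set [set 0]] /\
  forall a : ord, dclY a = [set L | sh_ideal L /\
    forall L', sh_ideal L' -> L' `<` L -> exists2 b, xlt b a & dclY b L'].
Proof.
split=> [|a]; apply/seteqP; split=> L /=.
- by move=> H; inversion H.
- by move=> ->; constructor.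
- by move=> H; inversion H; split.
- by case=> ? ?; constructor.
Qed.

Definition dclY_full (k : xord) : Prop := dclY k = sh_ideal.

Definition has_dclkdim : Prop := exists k, dclY_full k.

Definition is_dclkdim (k : xord) : Prop :=
  dclY_full k /\ forall l, dclY_full l -> xle k l.

Definition nzsh : Type := {L : set R | sh_ideal L /\ L <> [set 0]}.
HB.instance Definition _ := gen_eqMixin nzsh.
HB.instance Definition _ := gen_choiceMixin nzsh.

Definition nzsh_V I : set nzsh := [set L | sval L `<=` I].

Lemma nzsh_V_cover : \bigcup_(I in ideal) nzsh_V I = setT.
Proof. by apply/seteqP; split=> // L _; exists setT. Qed.

Lemma nzsh_V_join I J (L : nzsh) : ideal I -> ideal J ->
  nzsh_V I L -> nzsh_V J L ->
  exists K, [/\ ideal K, nzsh_V K L & nzsh_V K `<=` nzsh_V I `&` nzsh_V J].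
Proof.
move=> [I0 ID IMl IMr] [J0 JD JMl JMr] LI LJ; exists (I `&` J); split.
- split=> [//|x y [? ?] [? ?]|r x [? ?]|r x [? ?]].
  + by split; [exact: ID|exact: JD].
  + by split; [exact: IMl|exact: JMl].
  + by split; [exact: IMr|exact: JMr].
- by move=> x Lx; split; [exact: LI|exact: LJ].
- by move=> M MIJ; split=> x /MIJ [].
Qed.

HB.instance Definition _ :=
  isBaseTopological.Build nzsh nzsh_V_cover nzsh_V_join.

Lemma nzsh_open : open =
  [set \bigcup_(I in D) nzsh_V I | D in [set D | D `<=` ideal]].
Proof. by []. Qed.

End Ideals.

(** [derived T a] is the a-th iterated derived set of [T]; [derivedE] is its
    recursive definition. *)
Inductive derived (T : topologicalType) : ord -> set T :=
| derived_zero x : derived ozero x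
| derived_succ a x of limit_point (derived a) x : derived (osucc a) x
| derived_limit a x of olimit a & (forall b, olt b a -> derived b x) :
    derived a x.

Lemma osucc_inj : injective osucc.
Proof.
move=> a b E; have /olt_succ ab : olt a (osucc b).
  by rewrite -E; apply/olt_succ; exact: tle_refl.
have /olt_succ ba : olt b (osucc a).
  by rewrite E; apply/olt_succ; exact: tle_refl.
by rewrite -(oreprK a) -(oreprK b); exact: eq_ord_of.
Qed.

Lemma osucc_neq0 a : osucc a <> ozero.
Proof.
move=> E; apply: (@olt_irr a).
apply: tlt_le_trans (ozero_le a); rewrite -E.
by apply/olt_succ; exact: tle_refl.
Qed.

Lemma derivedE (T : topologicalType) :
  [/\ @derived T ozero = setT,
      forall a, @derived T (osucc a) = limit_point (@derived T a) &
      forall a, olimit a ->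
        @derived T a = [set x | forall b, olt b a -> @derived T b x]].
Proof.
split=> [|a|a la]; apply/seteqP; split=> x //.
- by move=> _; constructor.
- move E : (osucc a) => c H; case: H E => [y /osucc_neq0 //|b y lb|b y [_ +] _].
    by move/osucc_inj ->.
  by move=> /(_ a) nb /esym /nb.
- exact: derived_succ.
- move=> H; case: H la => [y [] //|b y _ [_ /(_ b)] //|b y _ lb _ c]; exact: lb.
- by move=> H; apply: derived_limit.
Qed.

Definition has_derived_dim (T : topologicalType) : Prop :=
  exists a, @derived T a = set0.

Definition is_derived_dim (T : topologicalType) (d : ord) : Prop :=
  @derived T d = set0 /\ forall a, @derived T a = set0 -> ole d a.

Lemma derived_dim_exists (T : topologicalType) :
  has_derived_dim T -> exists! d, is_derived_dim T d.
Proof.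
case; apply: (well_founded_ind olt_wf) => a IH a0.
have [[b ba b0]|N] := pselect (exists2 b, olt b a & @derived T b = set0).
  exact: (IH b ba b0).
have da : is_derived_dim T a.
  split=> // b b0; have [//|ba] := ole_total a b.
  by case: N; exists b.
exists a; split=> // b [b0 bmin].
rewrite -(oreprK a) -(oreprK b); apply: eq_ord_of; last exact: bmin.
by case: da => _; exact.
Qed.

Lemma dclkdim_exists (R : nzRingType) :
  has_dclkdim R -> exists! k, is_dclkdim R k.
Proof.
move=> H; have [k dk] : exists k, is_dclkdim R k.
  case: H => -[|a] ka.
    by exists XMinus1; split=> // -[|b] _; [right|left].
  have [m1|nm1] := pselect (dclY_full R XMinus1).
    by exists XMinus1; split=> // -[|b] _; [right|left].
  move: a ka; apply: (well_founded_ind olt_wf) => a IH ka.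
  have [[b ba kb]|N] := pselect (exists2 b, olt b a & dclY_full R (XOrd b)).
    exact: (IH b ba kb).
  exists (XOrd a); split=> // -[//|b kb].
  have [/ole_eqVlt[ab|->]|ba] := ole_total a b; [by left|by right|].
  by case: N; exists b.
exists k; split=> // l [kl lmin]; case: dk => kk kmin.
case: (kmin _ kl) (lmin _ kk) => [|//] + [|//].
case: k l {kk kmin kl lmin} => [|a] [|b] //= ab ba.
by case: (olt_irr (olt_trans ab ba)).
Qed.

(* Main.v *)
Require Import Defs.
From HB Require Import structures.
From mathcomp Require Import all_boot all_order all_algebra.
From mathcomp Require Import all_classical topology.

(** In the W-topology the smallest neighbourhood of [L] is [V(L)], so [L] is a
    limit point of [A] iff some [L'] in [A] lies strictly below [L].  Hence both
    the derived sets and the Krull filtration are level sets of the rank of the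
    strict inclusion order on the non-zero strongly hollow ideals: [X_a] consists
    of the ideals whose rank is not below [a], and [Y_a] of [0] and the ideals of
    rank at most [a].  So [Y_k] is everything iff [X_(k+1)] is empty, and the
    Krull dimension is the least [k] with [d <= k + 1]. *)

Local Open Scope classical_set_scope.
Local Open Scope ring_scope.

Lemma ord_cases (a : ord) : [\/ a = ozero, exists b, a = osucc b | olimit a].
Proof.
have [->|a0] := pselect (a = ozero); first by constructor 1.
have [[b ->]|nb] := pselect (exists b, a = osucc b).
  by constructor 2; exists b.
by constructor 3; split=> // b ab; apply: nb; exists b.
Qed.

Lemma not_olt_ozero (a : ord) : ~ olt a ozero.
Proof. by move=> a0; apply: (@olt_irr a); exact: tlt_le_trans a0 (ozero_le a). Qed.

Lemma ole_succ_le {a b : ord} : ole (osucc a) b <-> olt a b.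
Proof.
split=> [|ab]; first by apply: tlt_le_trans; apply/olt_succ; exact: tle_refl.
have [//|/olt_succ ba] := ole_total (osucc a) b.
by have := tlt_le_trans ab ba => /olt_irr.
Qed.

Lemma ole_anti {a b : ord} : ole a b -> ole b a -> a = b.
Proof. by move=> /ole_eqVlt[ab ba|//]; have := tlt_le_trans ab ba => /olt_irr. Qed.

Lemma olimit_succ (a b : ord) : olimit a -> olt b a -> olt (osucc b) a.
Proof. by case=> _ /(_ b) nab /ole_succ_le /ole_eqVlt[//|/esym]. Qed.

Lemma xleE (a b : ord) : xle a b <-> ole a b.
Proof.
by rewrite ole_eqVlt; split=> -[|]; [left|case=> ->; right|left|move=> ->; right].
Qed.

(** [xsucc] with values in [ord], so that it can index derived sets; it is the shift by one between
    the two filtrations. *)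
Definition succx (k : xord) : ord := if k is XOrd a then osucc a else ozero.

Lemma xsuccE (k : xord) : xsucc k = succx k.
Proof. by case: k. Qed.

Lemma succx_mono (k l : xord) : xle k l -> ole (succx k) (succx l).
Proof.
case: k l => [|a] [|b] kl; try exact: ozero_le; first by case: kl.
by apply/ole_succ_le/olt_succ/xleE.
Qed.

Section DerivedRank.
Variables (T : topologicalType) (r : T -> T -> Prop).
Hypothesis limit_pointE :
  forall A x, limit_point A x <-> exists2 y, r y x & A y.

(** One criterion for zero, successor and limit stages alike: it says that the [r]-rank of [x] is at
    least [a]. *)
Lemma derivedP (a : ord) (x : T) :
  derived a x <-> forall b, olt b a -> exists2 y, r y x & derived b y.
Proof.
have [D0 DS DL] := derivedE T.
elim/(well_founded_ind olt_wf): a x => a IH x.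
case: (ord_cases a) IH => [->|[c ->]|la] IH.
- by rewrite D0; split=> // _ b /not_olt_ozero.
- rewrite DS limit_pointE; split=> [[y yx cy] b /olt_succ bc|]; last first.
    by apply; apply/olt_succ; exact: tle_refl.
  (* The witness for stage [c] serves every [b] up to [c]: by induction its membership is a
     condition on all [e] below the stage, which only weakens as the stage drops. *)
  exists y => //; apply/IH => [|e eb]; first exact/olt_succ.
  apply: (IH c _ y).1 cy _ _; first by apply/olt_succ; exact: tle_refl.
  exact: tlt_le_trans bc.
(* Below a limit, [b] and its successor both precede [a], and stage [osucc b] supplies the witness
   in stage [b]. *)
- rewrite DL //; split=> [H b /(olimit_succ _ _ la) /H|H b ba].
    by rewrite DS limit_pointE.
  by apply/IH => // e eb; apply: H; exact: olt_trans ba.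
Qed.

Lemma derived_anti (a b : ord) : ole a b -> @derived T b `<=` @derived T a.
Proof.
move=> ab x /derivedP H; apply/derivedP => c ca.
by apply: H; exact: tlt_le_trans ab.
Qed.

End DerivedRank.

Section StronglyHollow.
Variable R : nzRingType.
Implicit Types L : nzsh R.

Lemma ideal_set0 : ideal [set (0 : R)].
Proof.
by split=> //= [x y -> ->|s x ->|s x ->]; rewrite ?GRing.addr0 ?GRing.mulr0 ?GRing.mul0r.
Qed.

Lemma sh_ideal_set0 : sh_ideal [set (0 : R)].
Proof.
by split=> [|A B iA iB _]; [exact: ideal_set0|left=> _ ->; exact: ideal0 iA].
Qed.

Lemma nzsh_limit_point (A : set (nzsh R)) L :
  limit_point A L <-> exists2 L', sval L' `<` sval L & A L'.
Proof.
have neq L1 L2 : sval L1 = sval L2 -> L1 = L2.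
  by case: L1 L2 => [I pI] [J pJ] /= E; exact: eq_exist.
split=> [AL|[L' [L'L nLL'] AL'] U].
  have [|L' [L'L AL' VL']] := AL (nzsh_V (sval L)).
    apply: open_nbhs_nbhs; split=> //; rewrite nzsh_open /=.
    exists [set sval L]; last by rewrite bigcup_set1.
    by move=> _ ->; case: (svalP L) => -[].
  exists L' => //; split=> // LL'; move/eqP: L'L; apply.
  by apply: neq; apply/seteqP.
(* Open sets are unions of sets [nzsh_V I], each closed downwards under inclusion, so any one
   containing [L] contains [L']. *)
rewrite nbhsE => -[V [+ VL] VU]; rewrite nzsh_open => -[D Did DV].
exists L'; split=> //; first by apply/eqP => E; apply: nLL'; rewrite E.
apply: VU; move: VL; rewrite -DV => -[I DI LI].
by exists I => //; exact: subset_trans LI.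
Qed.

Lemma nzsh_derivedP (a : ord) L :
  derived a L <->
  forall b, olt b a -> exists2 L' : nzsh R, sval L' `<` sval L & derived b L'.
Proof. exact: (derivedP _ _ nzsh_limit_point). Qed.

Lemma dclY_sh (k : xord) (I : set R) : dclY k I -> sh_ideal I.
Proof. by case=> //; exact: sh_ideal_set0. Qed.

Lemma dclY_set0 (k : xord) : dclY k [set (0 : R)].
Proof.
case: k => [|a]; constructor; first exact: sh_ideal_set0.
move=> I [iI _] [_ nI]; case: nI => _ ->; exact: ideal0 iI.
Qed.

(** The shift is needed because rank at most [a] is the negation of rank at least [osucc a]. At -1
    both sides are false, as [L] is non-zero and stage [ozero] is the whole space. *)
Lemma dclY_derived (k : xord) L : dclY k (sval L) <-> ~ derived (succx k) L.
Proof.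
have [_ DS _] := derivedE (nzsh R); have [Ym1 YE] := dclYE R.
have nz (M : nzsh R) : ~ dclY XMinus1 (sval M) by rewrite Ym1; case: (svalP M).
case: k => [|a].
  by split=> [/nz//|]; case; apply/nzsh_derivedP => b /not_olt_ozero.
elim/(well_founded_ind olt_wf): a L => a IH L.
rewrite YE /= DS nzsh_limit_point; split.
  move=> [_ H] [M ML /nzsh_derivedP aM].
  have [[|b] /= ba bM] := H _ (svalP M).1 ML; first exact: nz bM.
  by apply: (IH b ba M).1 bM _; rewrite DS nzsh_limit_point; exact: aM.
move=> H; split=> [|I shI IL]; first exact: (svalP L).1.
have [->|nI] := pselect (I = [set 0]).
  by exists XMinus1 => //; exact: dclY_set0.
(* If [I] lay in no earlier [dclY b], induction would put it in every [derived (osucc b)] with [b]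
   below [a], hence in [derived a], making [L] a limit point of that set. *)
apply: contrapT => N; apply: H; pose M : nzsh R := exist _ I (conj shI nI).
exists M => //; apply/nzsh_derivedP => b ba.
rewrite -nzsh_limit_point -DS; apply: contrapT => /(IH b ba M).2 bM.
by apply: N; exists b.
Qed.

Lemma dclY_full_derived (k : xord) :
  dclY_full R k <-> @derived (nzsh R) (succx k) = set0.
Proof.
split=> [full|D0].
  apply/seteqP; split=> // L; apply: (dclY_derived k L).1.
  by rewrite full; exact: (svalP L).1.
apply/seteqP; split=> I; first exact: dclY_sh.
have [-> _|nI shI] := pselect (I = [set 0]); first exact: dclY_set0.
pose L : nzsh R := exist _ I (conj shI nI).
by apply/(dclY_derived k L); rewrite D0.
Qed.

Lemma derived_set0_le (a b : ord) :
  ole a b -> @derived (nzsh R) a = set0 -> @derived (nzsh R) b = set0.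
Proof.
move=> ab a0; apply/seteqP; split=> //; rewrite -a0.
exact: (derived_anti _ _ nzsh_limit_point).
Qed.

End StronglyHollow.

Theorem theorem3p7 (R : nzRingType) (hR : D_ring R) :
  (has_derived_dim (nzsh R) <-> has_dclkdim R) /\
  (forall (d : ord) (k : xord),
     is_derived_dim (nzsh R) d -> is_dclkdim R k ->
     [/\ xle k (XOrd d),
         xle (XOrd d) (xsucc k),
         olimit d -> XOrd d = k &
         ~ olimit d -> XOrd d = xsucc k]).
Proof.
have le_succ (a : ord) : ole a (osucc a).
  by apply/tltW/olt_succ; exact: tle_refl.
split.
  split=> [[a a0]|[k /dclY_full_derived k0]]; last by exists (succx k).
  by exists a; apply/dclY_full_derived; exact: derived_set0_le a0.
move=> d k; rewrite xsuccE => -[d0 dmin] [/dclY_full_derived k0 kmin].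
have kd : xle k d.
  by apply/kmin/dclY_full_derived; exact: derived_set0_le d0.
have dk : ole d (succx k) by exact: dmin.
split=> //; first exact/xleE.
  (* For [k] equal to -1, [d] would be zero; otherwise [d] is at most [osucc c] but not a successor,
     so it is at most [c]. *)
  move=> ld; case: k kd dk {k0 kmin} => [|c] kd dk.
    by case: ld.1; apply: ole_anti dk (ozero_le _).
  congr XOrd; apply: ole_anti; last exact/xleE.
  by apply/olt_succ; case/ole_eqVlt: dk => // dc; case: (ld.2 c).
move=> nld; congr XOrd; apply: ole_anti dk _.
(* A non-limit [d] is a shifted index, with [l] equal to -1 when [d] is zero; [dclY l] is then full,
   and minimality of [k] gives [k] at most [l]. *)
have [l dl] : exists l, d = succx l.
  case: (ord_cases d) => [->|[c ->]|//]; first by exists XMinus1.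
  by exists c.
by rewrite dl; apply/succx_mono/kmin/dclY_full_derived; rewrite -dl.
Qed.
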